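(* Let $x^{\mathrm c},x^{\mathrm g},\mu\in\mathbb{R}^n$, let $\Sigma\in\mathbb{R}^{n\times n}$ be symmetric positive definite with eigendecomposition $\Sigma=UDU^T$ ($U$ orthogonal with columns $u_1,\dots,u_n$, $D$ diagonal with positive entries $D_{ii}$), let $\tilde\mu=\Sigma^{-1}\mu$, and let $\mathcal{E}=\{y\in\mathbb{R}^n:(y-\mu)^T\Sigma^{-1}(y-\mu)\le 1\}$. Consider the projection problem $$\text{minimize over } x\in\mathbb{R}^n:\ \|x-x^{\mathrm g}\|_2^2\quad\text{subject to } x\in V(x^{\mathrm c},\mathcal{E}),$$ and the problem in the variables $x\in\mathbb{R}^n$, $\lambda\in\mathbb{R}$, $$\begin{aligned}\text{minimize}\quad &\|x-x^{\mathrm g}\|_2^2\\ \text{subject to}\quad &\|x^{\mathrm c}\|_2^2-2x^Tx^{\mathrm c}+\sum_{i=1}^n\frac{(u_i^Tx+\lambda u_i^T\tilde\mu)^2}{1+\lambda D_{ii}^{-1}}\le\lambda(\tilde\mu^T\Sigma\tilde\mu-1),\\ &\lambda\ge 0.\end{aligned}$$ Then the second problem is a convex optimization problem, representable as a second-order cone program, and it is equivalent to the projection problem: the two problems have the same optimal value, and for every optimal solution $(x,\lambda)$ of the second problem, $x$ is an optimal solution of the projection problem.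
   Context: For a point $x^{\mathrm c}\in\mathbb{R}^n$ (the agent's current position) and a set $\mathcal{E}\subset\mathbb{R}^n$, the generalized Voronoi region is $V(x^{\mathrm c},\mathcal{E})=\{z\in\mathbb{R}^n:\|z-x^{\mathrm c}\|_2\le\inf_{y\in\mathcal{E}}\|z-y\|_2\}$. The point $x^{\mathrm g}$ is the goal to be projected. A problem is representable as a second-order cone program if, possibly after introducing auxiliary variables and an epigraph variable for the objective, it can be written as minimizing a linear function subject to affine and second-order cone constraints. *)

(* Defs.v *)
(* MathComp / MathComp-Analysis; the reals are an arbitrary realType. *)
From HB Require Import structures.
From mathcomp Require Export all_boot all_order all_algebra.
From mathcomp Require Export all_classical all_reals all_analysis.

Set Implicit Arguments.
Unset Strict Implicit.
Unset Printing Implicit Defensive.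

Import Order.TTheory GRing.Theory Num.Theory.
Import numFieldNormedType.Exports.

Local Open Scope classical_set_scope.
Local Open Scope ring_scope.

Section Euclidean.
Context {R : realType}.

Definition dotv n (u v : 'cV[R]_n) : R := (u^T *m v) 0 0.

(* The library norm on matrices is the sup norm, hence this definition. *)
Definition norm2 n (v : 'cV[R]_n) : R := Num.sqrt (dotv v v).

Definition posdef n (A : 'M[R]_n) : Prop :=
  A^T = A /\ forall v : 'cV[R]_n, v != 0 -> 0 < dotv v (A *m v).

(* The infimum is taken in the extended reals, so that it is +oo for an empty
   set E. *)
Definition voronoi n (xc : 'cV[R]_n) (E : set 'cV[R]_n) : set 'cV[R]_n :=
  [set z | ((norm2 (z - xc))%:E <=
            ereal_inf [set (norm2 (z - y))%:E | y in E])%E].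

Definition ellipsoid n (mu : 'cV[R]_n) (Sigma : 'M[R]_n) : set 'cV[R]_n :=
  [set y | dotv (y - mu) (invmx Sigma *m (y - mu)) <= 1].

End Euclidean.

Section Optimization.
Context {R : realType}.

Record opt_problem N := OptProblem {
  cost : 'cV[R]_N -> R;
  feasible : set 'cV[R]_N }.

Definition optimal_value N (P : opt_problem N) : \bar R :=
  ereal_inf [set (cost P z)%:E | z in feasible P].

Definition optimal N (P : opt_problem N) (z : 'cV[R]_N) : Prop :=
  feasible P z /\ forall z', feasible P z' -> cost P z <= cost P z'.

(* Inequality form: minimize ineq_cost z subject to f z <= 0 for every f in
   ineqs.  The domain carries the points where all these functions are defined,
   which Rocq's total functions do not record. *)
Record ineq_problem N := IneqProblem {
  domain : set 'cV[R]_N;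
  ineq_cost : 'cV[R]_N -> R;
  ineq_num : nat;
  ineqs : ineq_num.-tuple ('cV[R]_N -> R) }.

Definition opt_of_ineq N (P : ineq_problem N) : opt_problem N :=
  OptProblem (ineq_cost P)
    [set z | domain P z /\ forall j, tnth (ineqs P) j z <= 0].

Definition convex_problem N (P : ineq_problem N) : Prop :=
  [/\ convex_set (domain P),
      convex_function (domain P) (ineq_cost P) &
      forall j, convex_function (domain P) (tnth (ineqs P) j)].

(* The constraint | A z + b | <= c^T z + d.  With no rows it is the affine
   inequality 0 <= c^T z + d. *)
Record soc_constraint N := SocConstraint {
  soc_rows : nat;
  soc_A : 'M[R]_(soc_rows, N);
  soc_b : 'cV[R]_soc_rows;
  soc_c : 'cV[R]_N;
  soc_d : R }.

Definition soc_holds N (C : soc_constraint N) (z : 'cV[R]_N) : Prop :=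
  norm2 (soc_A C *m z + soc_b C) <= dotv (soc_c C) z + soc_d C.

Record socp N := Socp {
  socp_cost : 'cV[R]_N;
  socp_eqs : nat;
  socp_F : 'M[R]_(socp_eqs, N);
  socp_g : 'cV[R]_socp_eqs;
  socp_num : nat;
  socp_cones : socp_num.-tuple (soc_constraint N) }.

Definition opt_of_socp N (Q : socp N) : opt_problem N :=
  OptProblem (dotv (socp_cost Q))
    [set z | socp_F Q *m z = socp_g Q /\
             forall j, soc_holds (tnth (socp_cones Q) j) z].

(* Q has variables z (those of P), t (epigraph) and w (k auxiliary ones),
   stacked in this order; it minimizes t, and eliminating w from its constraints
   gives the epigraph of P. *)
Definition socp_representable N (P : opt_problem N) : Prop :=
  exists (k : nat) (Q : socp (N + 1 + k)),
    (forall z t w, cost (opt_of_socp Q) (col_mx (col_mx z t%:M) w) = t) /\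
    (forall z t, feasible P z /\ cost P z <= t <->
      exists w, feasible (opt_of_socp Q) (col_mx (col_mx z t%:M) w)).

End Optimization.

Section Projection.
Context {R : realType} (n : nat).
Implicit Types (x xc xg mu mut : 'cV[R]_n) (Sigma U D : 'M[R]_n) (lam : R).

Definition projection_problem xc xg mu Sigma : opt_problem n :=
  OptProblem (fun x => norm2 (x - xg) ^+ 2)
    (voronoi xc (ellipsoid mu Sigma)).

Definition dual_lhs xc U D mut x lam : R :=
  norm2 xc ^+ 2 - 2 * dotv x xc +
  \sum_(i < n) (dotv (col i U) x + lam * dotv (col i U) mut) ^+ 2 /
               (1 + lam * (D i i)^-1).

Definition dual_rhs Sigma mut lam : R :=
  lam * (dotv mut (Sigma *m mut) - 1).

(* The variables x and lambda are stacked as z = (x, lambda). *)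
Definition xpart (z : 'cV[R]_(n + 1)) : 'cV[R]_n := usubmx z.
Definition lampart (z : 'cV[R]_(n + 1)) : R := dsubmx z 0 0.

(* The fractions are quadratic-over-linear functions a^2 / b, whose domain is
   b > 0.  This does not restrict the feasible set, see dual_feasibleE. *)
Definition dual_problem xc xg Sigma U D mut : ineq_problem (n + 1) :=
  IneqProblem
    [set z | forall i, 0 < 1 + lampart z * (D i i)^-1]
    (fun z => norm2 (xpart z - xg) ^+ 2)
    [tuple (fun z => dual_lhs xc U D mut (xpart z) (lampart z) -
                     dual_rhs Sigma mut (lampart z));
           (fun z => - lampart z)].

Lemma dual_feasibleE xc xg Sigma U D mut x lam :
  (forall i, 0 < D i i) ->
  feasible (opt_of_ineq (dual_problem xc xg Sigma U D mut))
    (col_mx x lam%:M) <->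
  dual_lhs xc U D mut x lam <= dual_rhs Sigma mut lam /\ 0 <= lam.
Proof.
move=> D0; pose z := col_mx x lam%:M : 'cV[R]_(n + 1).
have xE : xpart z = x by exact: col_mxKu.
have lE : lampart z = lam by rewrite /lampart col_mxKd mxE eqxx mulr1n.
rewrite -/z; split=> [[_ h]|[h lam0]].
  move: (h ord0) (h ord_max); rewrite !(tnth_nth (fun=> 0)) /=.
  by rewrite xE lE subr_le0 oppr_le0.
split=> [i|j].
  by rewrite lE ltr_pwDl// mulr_ge0// invr_ge0 ltW.
rewrite (tnth_nth (fun=> 0)).
by case: j => [[|[|//]]] _ /=; rewrite ?xE lE ?subr_le0 ?oppr_le0.
Qed.

End Projection.

(* Main.v *)
From mathcomp Require Import ring lra.
Require Import Defs.

Set Implicit Arguments.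
Unset Strict Implicit.
Unset Printing Implicit Defensive.

Import Order.TTheory GRing.Theory Num.Theory.
Import numFieldNormedType.Exports.

Local Open Scope classical_set_scope.
Local Open Scope ring_scope.

(** Subtracting |x|^2 from both sides of |x - xc|^2 <= |x - y|^2 shows that x
    lies in the Voronoi region exactly when
      |xc|^2 - 2 x.xc <= |y|^2 - 2 x.y    for every y in the ellipsoid,
    i.e. when the left-hand side is at most the minimum over the ellipsoid of
    the convex quadratic y |-> |y|^2 - 2 x.y ([voronoiP]).  This semi-infinite
    condition becomes finite by Lagrangian duality.  In the eigenbasis U
    everything is separable: the Lagrangian with multiplier lam is minimized
    coordinate by coordinate, the dual constraint says that
    |xc|^2 - 2 x.xc is at most its minimum [dual_value], and any lam >= 0 satisfying that
    constraint certifies membership ([weak_duality]).  Conversely the minimum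
    over the ellipsoid equals [dual_value] at some lam ([strong_duality]): the
    minimizer y(lam) of the Lagrangian has i-th coordinate
    (xi_i + lam m_i) / (1 + lam / d_i), so that its offset from the centre
    d_i m_i of the ellipsoid is (xi_i - d_i m_i) / (1 + lam / d_i).  Starting
    from y(0) = x it moves continuously towards the centre; if x is outside the
    ellipsoid, y(lam) crosses the boundary by the intermediate value theorem,
    and there complementary slackness lam * gap = 0 makes the primal and dual
    values equal.

    Hence the projection problem is the dual problem with lam eliminated by
    projection ([voronoi_dualP]), and since the cost does not depend on lam
    the optimal values agree and optimal solutions project to optimal
    solutions.

    The dual problem is convex because a^2 / b is jointly convex on b > 0
    ([quad_over_lin_convex]).  It is a second-order cone program because
    a^2 / b <= w is the hyperbolic constraint a^2 <= w b, which is the cone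
    constraint |(2 a, w - b)| <= w + b ([hyperbolic_constraintP]); one
    auxiliary variable w_i bounds each fraction, and the quadratic cost is
    bounded by the epigraph variable t in the same way. *)

(** * Euclidean geometry *)

Section InnerProduct.
Context {R : realType}.

Lemma dotvE n (u v : 'cV[R]_n) : dotv u v = \sum_i u i 0 * v i 0.
Proof. by rewrite /dotv mxE; apply: eq_bigr => i _; rewrite mxE. Qed.

Lemma dotvC n (u v : 'cV[R]_n) : dotv u v = dotv v u.
Proof. by rewrite !dotvE; apply: eq_bigr => i _; rewrite mulrC. Qed.

Lemma dotvDr n (u v w : 'cV[R]_n) : dotv u (v + w) = dotv u v + dotv u w.
Proof. by rewrite /dotv mulmxDr mxE. Qed.

Lemma dotvZr n a (u v : 'cV[R]_n) : dotv u (a *: v) = a * dotv u v.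
Proof. by rewrite /dotv -scalemxAr mxE. Qed.

Lemma dotvNr n (u v : 'cV[R]_n) : dotv u (- v) = - dotv u v.
Proof. by rewrite /dotv mulmxN mxE. Qed.

Lemma dotvBr n (u v w : 'cV[R]_n) : dotv u (v - w) = dotv u v - dotv u w.
Proof. by rewrite dotvDr dotvNr. Qed.

Lemma dotvDl n (u v w : 'cV[R]_n) : dotv (u + v) w = dotv u w + dotv v w.
Proof. by rewrite ![dotv _ w]dotvC dotvDr. Qed.

Lemma dotvZl n a (u v : 'cV[R]_n) : dotv (a *: u) v = a * dotv u v.
Proof. by rewrite ![dotv _ v]dotvC dotvZr. Qed.

Lemma dotvNl n (u v : 'cV[R]_n) : dotv (- u) v = - dotv u v.
Proof. by rewrite ![dotv _ v]dotvC dotvNr. Qed.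

Lemma dotvBl n (u v w : 'cV[R]_n) : dotv (u - v) w = dotv u w - dotv v w.
Proof. by rewrite dotvDl dotvNl. Qed.

Lemma dotv0l n (v : 'cV[R]_n) : dotv 0 v = 0.
Proof. by rewrite /dotv trmx0 mul0mx mxE. Qed.

Lemma dotv_ge0 n (v : 'cV[R]_n) : 0 <= dotv v v.
Proof. by rewrite dotvE sumr_ge0 // => i _; rewrite -expr2 sqr_ge0. Qed.

Lemma dotv_col_mx m n (a c : 'cV[R]_m) (b d : 'cV[R]_n) :
  dotv (col_mx a b) (col_mx c d) = dotv a c + dotv b d.
Proof. by rewrite /dotv tr_col_mx mul_row_col mxE. Qed.

Lemma dotv_scalar (a b : R) : dotv (a%:M : 'cV_1) b%:M = a * b.
Proof. by rewrite dotvE big_ord1 !mxE !mulr1n. Qed.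

Lemma dotv_delta n (i : 'I_n) (w : 'cV[R]_n) : dotv (delta_mx i 0) w = w i 0.
Proof.
rewrite dotvE (bigD1 i)//= big1 ?mxE ?eqxx ?mul1r ?addr0// => j ji.
by rewrite mxE (negPf ji) mul0r.
Qed.

Lemma norm2_sqr n (v : 'cV[R]_n) : norm2 v ^+ 2 = dotv v v.
Proof. by rewrite sqr_sqrtr // dotv_ge0. Qed.

(** The conjunct 0 <= r is needed: squaring loses the sign of r. *)
Lemma norm2_leE n (v : 'cV[R]_n) (r : R) :
  (norm2 v <= r) = (dotv v v <= r ^+ 2) && (0 <= r).
Proof.
have v0 : 0 <= norm2 v by exact: sqrtr_ge0.
have [r0|r0] := leP 0 r; last first.
  by rewrite andbF; apply/negbTE; rewrite -ltNge (lt_le_trans r0).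
by rewrite andbT -norm2_sqr ler_sqr.
Qed.

(** The terms |x|^2 cancel, so that membership is linear in x for each y. *)
Lemma voronoiP n (xc x : 'cV[R]_n) (E : set 'cV[R]_n) :
  voronoi xc E x <->
  forall y, E y ->
    norm2 xc ^+ 2 - 2 * dotv x xc <= dotv y y - 2 * dotv x y.
Proof.
have expand y : (norm2 (x - xc) <= norm2 (x - y)) =
    (norm2 xc ^+ 2 - 2 * dotv x xc <= dotv y y - 2 * dotv x y).
  rewrite norm2_leE sqrtr_ge0 andbT !norm2_sqr !(dotvBl, dotvBr).
  by rewrite (dotvC xc x) (dotvC y x); apply/idP/idP; lra.
split=> [Vx y Ey|h].
  rewrite -expand -lee_fin; apply: le_trans Vx _.
  by apply: ereal_inf_lbound; exists y.
by apply: le_ereal_inf_tmp => _ [y Ey <-]; rewrite lee_fin expand h.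
Qed.

End InnerProduct.

(** * Strong duality in coordinates *)

Lemma denom_gt0 (R : realType) (a lam : R) :
  0 < a -> 0 <= lam -> 0 < 1 + lam * a^-1.
Proof. by move=> a0 l0; rewrite ltr_pwDl// mulr_ge0// invr_ge0 ltW. Qed.

Section Duality.
Context {R : realType} (n : nat).
(* In the eigenbasis: d are the eigenvalues of Sigma, m the coordinates of
   Sigma^-1 mu, so that the ellipsoid has centre d m, and xi those of x. *)
Variables (d m xi : 'I_n -> R).
Hypothesis d_gt0 : forall i, 0 < d i.

Definition ellipsoid_gap (eta : 'I_n -> R) : R :=
  \sum_i (eta i - d i * m i) ^+ 2 / d i - 1.

Definition objective (eta : 'I_n -> R) : R :=
  \sum_i eta i ^+ 2 - 2 * \sum_i xi i * eta i.

(** The minimum over eta of the Lagrangian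
    objective eta + lam * ellipsoid_gap eta; see [lagrangianE]. *)
Definition dual_value (lam : R) : R :=
  lam * (\sum_i d i * m i ^+ 2 - 1) -
  \sum_i (xi i + lam * m i) ^+ 2 / (1 + lam * (d i)^-1).

Definition minimizer (lam : R) (i : 'I_n) : R :=
  (xi i + lam * m i) / (1 + lam * (d i)^-1).

(** Completing the square in each coordinate: the Lagrangian exceeds its
    minimum by squares weighted by the curvatures 1 + lam / d_i. *)
Lemma lagrangianE lam eta : 0 <= lam ->
  objective eta + lam * ellipsoid_gap eta =
  dual_value lam +
  \sum_i (1 + lam * (d i)^-1) * (eta i - minimizer lam i) ^+ 2.
Proof.
move=> l0.
have key i : eta i ^+ 2 - 2 * (xi i * eta i) +
    lam * ((eta i - d i * m i) ^+ 2 / d i) =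
    lam * (d i * m i ^+ 2)
    - (xi i + lam * m i) ^+ 2 / (1 + lam * (d i)^-1)
    + (1 + lam * (d i)^-1) * (eta i - minimizer lam i) ^+ 2.
  have di : d i != 0 by rewrite gt_eqF.
  have bi : 1 + lam * (d i)^-1 != 0 by rewrite gt_eqF// denom_gt0.
  have bi' : d i + lam != 0 by rewrite gt_eqF// ltr_wpDr.
  by rewrite /minimizer; field; rewrite ?di ?bi'.
rewrite /objective /ellipsoid_gap /dual_value !mulrBr !mulr_sumr mulr1.
transitivity (\sum_i (eta i ^+ 2 - 2 * (xi i * eta i) +
    lam * ((eta i - d i * m i) ^+ 2 / d i)) - lam).
  by rewrite big_split/= sumrB addrA.
by rewrite (eq_bigr _ (fun i _ => key i)) big_split/= sumrB; ring.
Qed.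

Lemma weak_duality lam eta : 0 <= lam -> ellipsoid_gap eta <= 0 ->
  dual_value lam <= objective eta.
Proof.
move=> l0 g0; have := lagrangianE eta l0.
have : 0 <= \sum_i (1 + lam * (d i)^-1) * (eta i - minimizer lam i) ^+ 2.
  by apply: sumr_ge0 => i _; rewrite mulr_ge0 ?sqr_ge0// ltW// denom_gt0.
have : 0 <= lam * - ellipsoid_gap eta by rewrite mulr_ge0 ?oppr_ge0.
lra.
Qed.

Lemma objective_minimizer lam : 0 <= lam ->
  objective (minimizer lam) + lam * ellipsoid_gap (minimizer lam) =
  dual_value lam.
Proof.
move=> l0; rewrite lagrangianE// big1 ?addr0// => i _.
by rewrite subrr expr0n mulr0.
Qed.

(** The i-th offset of the minimizer from the centre of the ellipsoid is that
    of xi divided by 1 + lam / d_i. *)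
Lemma gap_minimizerE lam : 0 <= lam ->
  ellipsoid_gap (minimizer lam) =
  \sum_i (xi i - d i * m i) ^+ 2 / d i * (1 + lam * (d i)^-1) ^- 2 - 1.
Proof.
move=> l0; congr (_ - 1); apply: eq_bigr => i _.
have di : d i != 0 by rewrite gt_eqF.
have bi' : d i + lam != 0 by rewrite gt_eqF// ltr_wpDr.
by rewrite /minimizer; field; rewrite ?di ?bi'.
Qed.

(** Intermediate value theorem between lam = 0 and lam = S + 1, where S is the
    squared distance from xi to the centre: d_i (1 + lam / d_i)^2 >= lam bounds
    the sum in [gap_minimizerE] by S / lam, which is below 1 at S + 1. *)
Lemma gap_minimizer_root : 0 <= ellipsoid_gap (minimizer 0) ->
  exists2 lam, 0 <= lam & ellipsoid_gap (minimizer lam) = 0.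
Proof.
move=> g0; pose S := \sum_i (xi i - d i * m i) ^+ 2.
have S0 : 0 <= S by apply: sumr_ge0 => i _; rewrite sqr_ge0.
have L0 : 0 <= S + 1 by lra.
have gL : ellipsoid_gap (minimizer (S + 1)) <= 0.
  rewrite gap_minimizerE// subr_le0.
  apply: (@le_trans _ _ (S / (S + 1))); last by rewrite ler_pdivrMr; lra.
  rewrite {1}/S mulr_suml; apply: ler_sum => i _.
  have L1 : 0 < S + 1 by lra.
  rewrite -mulrA ler_wpM2l ?sqr_ge0// -invfM lef_pV2 ?posrE//; last first.
    by rewrite mulr_gt0// exprn_gt0// denom_gt0.
  have -> : d i * (1 + (S + 1) * (d i)^-1) ^+ 2 =
     d i + 2 * (S + 1) + (S + 1) ^+ 2 * (d i)^-1.
    by field; rewrite gt_eqF.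
  have : 0 <= (S + 1) ^+ 2 * (d i)^-1 by rewrite mulr_ge0 ?sqr_ge0 ?invr_ge0 ?ltW.
  by have := d_gt0 i; lra.
pose f lam := \sum_i (xi i - d i * m i) ^+ 2 / d i *
   (1 + lam * (d i)^-1) ^- 2 - 1.
have f_cont : {within `[0, S + 1], continuous f}.
  apply: continuous_in_subspaceT => lam; rewrite inE/= in_itv/= => /andP[l0 _].
  apply: cvgB; last exact: cvg_cst.
  apply: cvg_big => [|i _]; first exact: add_continuous.
  apply: cvgM; first exact: cvg_cst.
  apply: cvgV; first by rewrite expf_neq0// gt_eqF// denom_gt0.
  rewrite expr2; under eq_cvg do rewrite expr2.
  by apply: cvgM; (apply: cvgD; first exact: cvg_cst);
     apply: cvgM => //; exact: cvg_cst.
have [|lam] := @IVT R f 0 (S + 1) 0 L0 f_cont.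
  by rewrite ge_min le_max /f -!gap_minimizerE// gL g0 orbT.
rewrite in_itv/= => /andP[l0 _] fl; exists lam => //.
by rewrite gap_minimizerE.
Qed.

(** Either xi itself is in the ellipsoid and lam = 0 works, or the multiplier
    is chosen so that the minimizer is on the boundary; in both cases
    lam * ellipsoid_gap vanishes. *)
Lemma strong_duality : exists lam eta,
  [/\ 0 <= lam, ellipsoid_gap eta <= 0 & objective eta = dual_value lam].
Proof.
have [g0|/ltW g0] := leP (ellipsoid_gap (minimizer 0)) 0.
  exists 0, (minimizer 0); split=> //.
  by rewrite -objective_minimizer// mul0r addr0.
have [lam l0 gl] := gap_minimizer_root g0.
exists lam, (minimizer lam); split=> //; first by rewrite gl.
by rewrite -objective_minimizer// gl mulr0 addr0.
Qed.

End Duality.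

(** * Convexity *)

Section Convexity.
Context {R : realType}.

(** Replaces the library's convex combinations, indexed by a bundled element of
    [0, 1], by two nonnegative weights of sum 1. *)
Lemma convex_functionI N (D : set 'cV[R]_N) (f : 'cV[R]_N -> R) :
  (forall (t s : R) x y, 0 <= t -> 0 <= s -> t + s = 1 -> D x -> D y ->
     f (t *: x + s *: y) <= t * f x + s * f y) ->
  convex_function D f.
Proof.
move=> h t x y; rewrite !inE => Dx Dy; rewrite convRE.
apply: (h t%:num (1 - t%:num) x y) => //.
by rewrite addrC subrK.
Qed.

Lemma convex_setI N (D : set 'cV[R]_N) :
  (forall (t s : R) x y, 0 <= t -> 0 <= s -> t + s = 1 -> D x -> D y ->
     D (t *: x + s *: y)) ->
  convex_set D.
Proof.
move=> h x y t; rewrite !inE => Dx Dy.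
apply: (h t%:num (1 - t%:num) x y) => //.
by rewrite addrC subrK.
Qed.

Lemma convex_comb_gt0 (t s b b' : R) : 0 <= t -> 0 <= s -> t + s = 1 ->
  0 < b -> 0 < b' -> 0 < t * b + s * b'.
Proof.
move=> t0 s0 ts b0 b0'; have [te|tn0] := eqVneq t 0.
  have -> : s = 1 by lra.
  by rewrite te mul0r add0r mul1r.
by rewrite ltr_pwDl ?mulr_ge0 ?(ltW b0')// mulr_gt0// lt0r tn0.
Qed.

(** The gap between the two sides is
    t s (a b' - a' b)^2 / (b b' (t b + s b')). *)
Lemma quad_over_lin_convex (t s a a' b b' : R) :
  0 <= t -> 0 <= s -> t + s = 1 -> 0 < b -> 0 < b' ->
  (t * a + s * a') ^+ 2 / (t * b + s * b') <=
  t * (a ^+ 2 / b) + s * (a' ^+ 2 / b').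
Proof.
move=> t0 s0 ts b0 b0'; have c0 := convex_comb_gt0 t0 s0 ts b0 b0'.
rewrite -subr_ge0.
have -> : t * (a ^+ 2 / b) + s * (a' ^+ 2 / b') -
    (t * a + s * a') ^+ 2 / (t * b + s * b') =
    t * s * (a * b' - a' * b) ^+ 2 / (b * b' * (t * b + s * b')).
  by field; rewrite !lt0r_neq0.
apply: divr_ge0; first by rewrite mulr_ge0 ?sqr_ge0// mulr_ge0.
by rewrite ltW// !mulr_gt0.
Qed.

(** The gap between the two sides is t s |u - v|^2. *)
Lemma dotv_sqr_convex n (t s : R) (u v : 'cV[R]_n) :
  0 <= t -> 0 <= s -> t + s = 1 ->
  dotv (t *: u + s *: v) (t *: u + s *: v) <= t * dotv u u + s * dotv v v.
Proof.
move=> t0 s0 ts; rewrite -subr_ge0.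
have -> : t * dotv u u + s * dotv v v -
    dotv (t *: u + s *: v) (t *: u + s *: v) =
    t * s * dotv (u - v) (u - v).
  rewrite !(dotvDl, dotvDr, dotvZl, dotvZr, dotvNl, dotvNr) (dotvC v u).
  have -> : s = 1 - t by lra.
  by ring.
by rewrite !mulr_ge0 ?dotv_ge0.
Qed.

End Convexity.

Section DualConvexity.
Context {R : realType} (n : nat).

Lemma xpart_comb (t s : R) (y z : 'cV[R]_(n + 1)) :
  xpart (t *: y + s *: z) = t *: xpart y + s *: xpart z.
Proof. by apply/colP => i; rewrite !mxE. Qed.

Lemma lampart_comb (t s : R) (y z : 'cV[R]_(n + 1)) :
  lampart (t *: y + s *: z) = t * lampart y + s * lampart z.
Proof. by rewrite /lampart !mxE. Qed.

(** On the domain, each fraction is a quadratic over a positive affine function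
    of (x, lambda); all remaining terms of the constraints are affine. *)
Lemma dual_problem_convex (xc xg mut : 'cV[R]_n) (Sigma U D : 'M[R]_n) :
  convex_problem (dual_problem xc xg Sigma U D mut).
Proof.
have dom t s (y z : 'cV[R]_(n + 1)) i : t + s = 1 ->
    1 + lampart (t *: y + s *: z) * (D i i)^-1 =
    t * (1 + lampart y * (D i i)^-1) + s * (1 + lampart z * (D i i)^-1).
  by move=> ts; rewrite lampart_comb -{1}ts; ring.
split=> [||j].
- apply: convex_setI => t s y z t0 s0 ts Dy Dz i.
  by rewrite dom// convex_comb_gt0.
- apply: convex_functionI => t s y z t0 s0 ts _ _ /=.
  rewrite xpart_comb !norm2_sqr.
  have -> : t *: xpart y + s *: xpart z - xg =
      t *: (xpart y - xg) + s *: (xpart z - xg).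
    by rewrite !scalerBr addrACA -opprD -scalerDl ts scale1r.
  exact: dotv_sqr_convex.
- apply: convex_functionI => t s y z t0 s0 ts Dy Dz.
  rewrite !(tnth_nth (fun=> 0)); case: j => [[|[|//]]] _ /=; last first.
    by rewrite lampart_comb; lra.
  pose Q (v : 'cV[R]_(n + 1)) := \sum_(i < n)
    (dotv (col i U) (xpart v) + lampart v * dotv (col i U) mut) ^+ 2 /
    (1 + lampart v * (D i i)^-1).
  have Qconv : Q (t *: y + s *: z) <= t * Q y + s * Q z.
    rewrite /Q !mulr_sumr -big_split/=; apply: ler_sum => i _.
    rewrite dom// xpart_comb lampart_comb dotvDr !dotvZr.
    apply: le_trans (quad_over_lin_convex _ _ t0 s0 ts (Dy i) (Dz i)).
    rewrite le_eqVlt; apply/orP; left; apply/eqP; congr (_ ^+ 2 / _).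
    by ring.
  rewrite /dual_lhs /dual_rhs -!/(Q _) xpart_comb lampart_comb.
  rewrite dotvDl !dotvZl -subr_ge0.
  move: (Q _) (Q y) (Q z) Qconv => q q1 q2; rewrite -subr_ge0.
  have -> : s = 1 - t by lra.
  by congr (0 <= _); ring.
Qed.

End DualConvexity.

(** * Second-order cone constraints *)

Section Cones.
Context {R : realType}.

(** A cone constraint without rows. *)
Definition affine_constraint N (c : 'cV[R]_N) (r : R) : soc_constraint N :=
  @SocConstraint R N 0 0 0 c r.

Lemma affine_constraintP N (c : 'cV[R]_N) (r : R) z :
  soc_holds (affine_constraint c r) z <-> 0 <= dotv c z + r.
Proof.
have v0 : norm2 (0 *m z + 0 : 'cV[R]_0) = 0.
  by rewrite /norm2 dotvE big_ord0 sqrtr0.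
by rewrite /soc_holds /= v0.
Qed.

(** With l1 = c1.z + r1 and l2 = c2.z + r2, the cone
    |(2 (A z + b), l1 - l2)| <= l1 + l2. *)
Definition hyperbolic_constraint p N (A : 'M[R]_(p, N)) (b : 'cV[R]_p)
    (c1 : 'cV[R]_N) (r1 : R) (c2 : 'cV[R]_N) (r2 : R) : soc_constraint N :=
  SocConstraint (col_mx (2 *: A) (c1 - c2)^T) (col_mx (2 *: b) (r1 - r2)%:M)
    (c1 + c2) (r1 + r2).

(** By (l1 + l2)^2 - (l1 - l2)^2 = 4 l1 l2, the cone expresses
    |A z + b|^2 <= l1 l2 on the half where l1 + l2 >= 0. *)
Lemma hyperbolic_constraintP p N (A : 'M[R]_(p, N)) b c1 r1 c2 r2 z :
  soc_holds (hyperbolic_constraint A b c1 r1 c2 r2) z <->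
  dotv (A *m z + b) (A *m z + b) <= (dotv c1 z + r1) * (dotv c2 z + r2) /\
  0 <= (dotv c1 z + r1) + (dotv c2 z + r2).
Proof.
rewrite /soc_holds /= norm2_leE mul_col_mx add_col_mx dotv_col_mx.
have -> : (c1 - c2)^T *m z = (dotv (c1 - c2) z)%:M by rewrite [LHS]mx11_scalar.
rewrite -raddfD dotv_scalar -scalemxAl -scalerDr dotvZl dotvZr.
rewrite dotvBl dotvDl.
set q := dotv (_ + b) _; set l1 := dotv c1 z; set l2 := dotv c2 z.
split=> [/andP[h1 h2]|[h1 h2]]; last (apply/andP; split); nra.
Qed.

Lemma forall_tnth_cons m (T : Type) (P : T -> Prop) a (s : m.-tuple T) :
  (forall j, P (tnth [tuple of a :: s] j)) <->
  P a /\ forall j, P (tnth s j).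
Proof.
split=> [h|[Pa Ps] j].
  split=> [|j]; first by have := h ord0; rewrite tnth0.
  by have := h (lift ord0 j); rewrite tnthS.
case: (unliftP ord0 j) => [i ->|->]; last by rewrite tnth0.
by rewrite tnthS.
Qed.

End Cones.

Section DualSocp.
Context {R : realType} (n : nat).
Variables (xc xg mut : 'cV[R]_n) (Sigma U D : 'M[R]_n).

Let socp_point (v : 'cV[R]_(n + 1)) (t : R) (w : 'cV[R]_n) :
    'cV[R]_(n + 1 + 1 + n) :=
  col_mx (col_mx v t%:M) w.

(** Coefficient vector of a linear form in the stacked variables
    x, lambda, t, w; see [functionalE]. *)
Definition functional (a : 'cV[R]_n) (l e : R) (g : 'cV[R]_n) :
    'cV[R]_(n + 1 + 1 + n) :=
  col_mx (col_mx (col_mx a l%:M) e%:M) g.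

Lemma functionalE a l e g v t w :
  dotv (functional a l e g) (socp_point v t w) =
  dotv a (xpart v) + l * lampart v + e * t + dotv g w.
Proof.
rewrite /socp_point -[v in LHS]vsubmxK [dsubmx v]mx11_scalar.
by rewrite !dotv_col_mx !dotv_scalar.
Qed.

Definition select_x : 'M[R]_(n, n + 1 + 1 + n) :=
  row_mx (row_mx (row_mx 1%:M 0) 0) 0.

Lemma select_xE v t w : select_x *m socp_point v t w = xpart v.
Proof.
rewrite /socp_point -[v in LHS]vsubmxK.
by rewrite !mul_row_col !mul0mx mul1mx !addr0.
Qed.

(** |x - xg|^2 <= t * 1. *)
Definition cost_cone :=
  hyperbolic_constraint select_x (- xg) (functional 0 0 1 0) 0 0 1.

(** The dual constraint after replacing its i-th fraction by w_i. *)
Definition dual_cone :=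
  affine_constraint
    (functional (2 *: xc) (dotv mut (Sigma *m mut) - 1) 0 (const_mx (-1)))
    (- norm2 xc ^+ 2).

Definition lambda_cone := affine_constraint (functional 0 1 0 0) 0.

(** (u_i.x + lambda u_i.mut)^2 <= w_i * (1 + lambda / D_ii). *)
Definition fraction_cone (i : 'I_n) :=
  hyperbolic_constraint
    (functional (col i U) (dotv (col i U) mut) 0 0)^T 0
    (functional 0 0 0 (delta_mx i 0)) 0
    (functional 0 (D i i)^-1 0 0) 1.

Definition dual_socp : socp (n + 1 + 1 + n) :=
  @Socp R _ (functional 0 0 1 0) 0 0 0 _
    [tuple of cost_cone :: [tuple of dual_cone ::
      [tuple of lambda_cone :: [tuple fraction_cone i | i < n]]]].

Lemma dual_socp_feasibleP v t w :
  feasible (opt_of_socp dual_socp) (socp_point v t w) <->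
  [/\ norm2 (xpart v - xg) ^+ 2 <= t,
      norm2 xc ^+ 2 - 2 * dotv (xpart v) xc + \sum_i w i 0 <=
        dual_rhs Sigma mut (lampart v),
      0 <= lampart v &
      forall i,
        (dotv (col i U) (xpart v) + lampart v * dotv (col i U) mut) ^+ 2 <=
        w i 0 * (1 + lampart v * (D i i)^-1) /\
        0 <= w i 0 + (1 + lampart v * (D i i)^-1)].
Proof.
pose holds C := soc_holds C (socp_point v t w).
have costP : soc_holds cost_cone (socp_point v t w) <->
    norm2 (xpart v - xg) ^+ 2 <= t.
  rewrite hyperbolic_constraintP select_xE functionalE !dotv0l norm2_sqr.
  have := dotv_ge0 (xpart v - xg).
  by split=> [[]|?]; [lra | split; lra].
have dualP : soc_holds dual_cone (socp_point v t w) <->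
    norm2 xc ^+ 2 - 2 * dotv (xpart v) xc + \sum_i w i 0 <=
    dual_rhs Sigma mut (lampart v).
  rewrite affine_constraintP functionalE dotvZl (dotvC xc) /dual_rhs.
  have -> : dotv (const_mx (-1)) w = - \sum_i w i 0.
    by rewrite dotvE -sumrN; apply: eq_bigr => i _; rewrite mxE mulN1r.
  by split; lra.
have lambdaP : soc_holds lambda_cone (socp_point v t w) <-> 0 <= lampart v.
  by rewrite affine_constraintP functionalE !dotv0l; split; lra.
have fractionP i : soc_holds (fraction_cone i) (socp_point v t w) <->
    (dotv (col i U) (xpart v) + lampart v * dotv (col i U) mut) ^+ 2 <=
    w i 0 * (1 + lampart v * (D i i)^-1) /\
    0 <= w i 0 + (1 + lampart v * (D i i)^-1).
  rewrite hyperbolic_constraintP !functionalE !dotv0l dotv_delta addr0.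
  rewrite [_^T *m _]mx11_scalar -/(dotv _ _) functionalE dotv_scalar dotv0l.
  rewrite !(mul0r, add0r, addr0) [_^-1 * _]mulrC [dotv _ mut * _]mulrC.
  by rewrite -expr2 [_ * _ + 1]addrC.
rewrite /=; split=> [[_]|[h1 h2 h3 h4]].
  move=> /(forall_tnth_cons holds)[/costP ? /(forall_tnth_cons holds)[/dualP ?]].
  move=> /(forall_tnth_cons holds)[/lambdaP ? h]; split=> // i.
  by apply/fractionP; have := h i; rewrite tnth_mktuple.
split; first by apply/matrixP => -[].
apply/(forall_tnth_cons holds); split; first exact/costP.
apply/(forall_tnth_cons holds); split; first exact/dualP.
apply/(forall_tnth_cons holds); split; first exact/lambdaP.
by move=> i; rewrite tnth_mktuple; apply/fractionP.
Qed.

Hypothesis D_gt0 : forall i, 0 < D i i.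

Lemma dual_feasibleP v :
  feasible (opt_of_ineq (dual_problem xc xg Sigma U D mut)) v <->
  dual_lhs xc U D mut (xpart v) (lampart v) <=
    dual_rhs Sigma mut (lampart v) /\ 0 <= lampart v.
Proof.
rewrite -[v in X in X <-> _]vsubmxK [dsubmx v]mx11_scalar.
exact: dual_feasibleE.
Qed.

(** Eliminating w: the dual constraint is increasing in each fraction, so some
    admissible w exists if and only if the smallest one, the fractions
    themselves, is admissible. *)
Lemma dual_socp_representable :
  socp_representable (opt_of_ineq (dual_problem xc xg Sigma U D mut)).
Proof.
exists n, dual_socp; split=> [v t w|v t].
  by rewrite [LHS]functionalE !dotv0l; lra.
have b_gt0 i : 0 <= lampart v -> 0 < 1 + lampart v * (D i i)^-1.
  exact: denom_gt0.
split=> [[/dual_feasibleP[h l0] ct]|[w /dual_socp_feasibleP[ct h l0 hw]]].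
  exists (\col_i ((dotv (col i U) (xpart v) +
    lampart v * dotv (col i U) mut) ^+ 2 / (1 + lampart v * (D i i)^-1))).
  apply/dual_socp_feasibleP; split=> // [|i].
    by under eq_bigr do rewrite mxE.
  have b0 := b_gt0 i l0; rewrite mxE divfK ?gt_eqF//; split=> //.
  by rewrite addr_ge0 ?divr_ge0 ?sqr_ge0// ltW.
split=> //; apply/dual_feasibleP; split=> //.
apply: le_trans h; rewrite lerD2l; apply: ler_sum => i _.
by rewrite ler_pdivrMr ?b_gt0//; case: (hw i).
Qed.

End DualSocp.

(** * Equivalence with the projection problem *)

Section Equivalence.
Context {R : realType} (n : nat).

Section Spectral.
Variables (U D : 'M[R]_n).
Hypotheses (hU : U^T *m U = 1%:M) (hD : is_diag_mx D).
Hypothesis D_gt0 : forall i, 0 < D i i.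

Lemma dotv_col i (v : 'cV[R]_n) : dotv (col i U) v = (U^T *m v) i 0.
Proof. by rewrite dotvE mxE; apply: eq_bigr => j _; rewrite !mxE. Qed.

Lemma dotv_orthogonal (u v : 'cV[R]_n) :
  dotv u v = \sum_i dotv (col i U) u * dotv (col i U) v.
Proof.
transitivity (dotv (U^T *m u) (U^T *m v)); last first.
  by rewrite dotvE; apply: eq_bigr => i _; rewrite !dotv_col.
by rewrite /dotv trmx_mul trmxK mulmxA -(mulmxA _ U) (mulmx1C hU) mulmx1.
Qed.

Lemma dotv_col_comb i (eta : 'I_n -> R) :
  dotv (col i U) (U *m \col_j eta j) = eta i.
Proof. by rewrite dotv_col mulmxA hU mul1mx mxE. Qed.

Lemma dotv_col_spectral i (v : 'cV[R]_n) :
  dotv (col i U) (U *m D *m U^T *m v) = D i i * dotv (col i U) v.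
Proof.
rewrite !dotv_col !mulmxA hU mul1mx -mulmxA; case/diag_mxP: hD => d ->.
by rewrite mul_diag_mx !mxE eqxx mulr1n.
Qed.

Lemma spectral_unit : U *m D *m U^T \in unitmx.
Proof.
have [U1 U1T] := mulmx1_unit hU.
rewrite !unitmx_mul U1 U1T andbT /= unitmxE.
have /diag_mxP[d dE] := hD; rewrite dE det_diag unitfE prodf_seq_neq0.
apply/allP => i _ /=; have := D_gt0 i.
by rewrite dE mxE eqxx mulr1n => /lt0r_neq0.
Qed.

Lemma dotv_col_spectral_inv i (v : 'cV[R]_n) :
  dotv (col i U) (invmx (U *m D *m U^T) *m v) = (D i i)^-1 * dotv (col i U) v.
Proof.
rewrite -[v in RHS](mulKVmx spectral_unit) dotv_col_spectral.
by rewrite mulKf// gt_eqF.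
Qed.

End Spectral.

Variables (xc xg mu mut : 'cV[R]_n) (Sigma U D : 'M[R]_n).
Hypotheses (hU : U^T *m U = 1%:M) (hD : is_diag_mx D).
Hypothesis D_gt0 : forall i, 0 < D i i.
Hypotheses (heig : Sigma = U *m D *m U^T) (hmut : mut = invmx Sigma *m mu).

Let d i := D i i.
Let m i := dotv (col i U) mut.
Let coord (v : 'cV[R]_n) i := dotv (col i U) v.

(** The centre mu = Sigma mut has coordinates d_i m_i. *)
Lemma ellipsoid_coordE y :
  ellipsoid mu Sigma y <-> ellipsoid_gap d m (coord y) <= 0.
Proof.
have muE i : coord mu i = d i * m i.
  rewrite /coord -(mulKVmx (spectral_unit hU hD D_gt0) mu) -heig -hmut heig.
  by rewrite dotv_col_spectral.
rewrite /ellipsoid /ellipsoid_gap /= subr_le0 (dotv_orthogonal hU).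
suff -> : \sum_i coord (y - mu) i * coord (invmx Sigma *m (y - mu)) i =
  \sum_i (coord y i - d i * m i) ^+ 2 / d i by [].
apply: eq_bigr => i _; rewrite -muE /coord heig dotv_col_spectral_inv//.
by rewrite dotvBr mulrCA mulrC.
Qed.

Lemma objective_coordE x y :
  dotv y y - 2 * dotv x y = objective (coord x) (coord y).
Proof.
by rewrite !(dotv_orthogonal hU); under eq_bigr do rewrite -expr2.
Qed.

Lemma dual_value_coordE x lam :
  dual_lhs xc U D mut x lam <= dual_rhs Sigma mut lam <->
  norm2 xc ^+ 2 - 2 * dotv x xc <= dual_value d m (coord x) lam.
Proof.
have -> : dual_rhs Sigma mut lam = lam * (\sum_i d i * m i ^+ 2 - 1).
  rewrite /dual_rhs (dotv_orthogonal hU); congr (_ * (_ - _)).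
  apply: eq_bigr => i _; rewrite heig dotv_col_spectral//.
  by rewrite mulrCA -expr2.
by rewrite /dual_lhs /dual_value lerBrDr.
Qed.

(** The minimum over the ellipsoid that describes the Voronoi region equals the
    maximum of the dual function, and the latter is attained. *)
Lemma voronoi_dualP x :
  voronoi xc (ellipsoid mu Sigma) x <->
  exists2 lam, 0 <= lam &
    dual_lhs xc U D mut x lam <= dual_rhs Sigma mut lam.
Proof.
split=> [/voronoiP Vx|[lam l0 /dual_value_coordE h]]; last first.
  apply/voronoiP => y /ellipsoid_coordE gy; rewrite objective_coordE.
  exact: le_trans h (weak_duality _ D_gt0 l0 gy).
have [lam [eta [l0 g0 etaE]]] := @strong_duality R n d m (coord x) D_gt0.
exists lam => //; apply/dual_value_coordE; rewrite -etaE.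
pose y := U *m \col_j eta j.
have yE : coord y = eta.
  by apply: funext => i; rewrite /coord dotv_col_comb.
by rewrite -yE -objective_coordE; apply: Vx; apply/ellipsoid_coordE; rewrite yE.
Qed.

Let P1 := projection_problem xc xg mu Sigma.
Let P2 := opt_of_ineq (dual_problem xc xg Sigma U D mut).

Lemma projection_feasibleP x :
  feasible P1 x <-> exists lam : R, feasible P2 (col_mx x lam%:M).
Proof.
rewrite [feasible P1 x]voronoi_dualP.
by split=> [[lam l0 h]|[lam /dual_feasibleE[//|h l0]]]; exists lam => //;
  apply/dual_feasibleE.
Qed.

Lemma dual_costE x (lam : R) : cost P2 (col_mx x lam%:M) = cost P1 x.
Proof. by rewrite /= /xpart col_mxKu. Qed.

(** The two problems have the same set of attained costs. *)
Lemma optimal_value_dual : optimal_value P2 = optimal_value P1.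
Proof.
congr ereal_inf; apply/seteqP; split=> _ [z Fz <-].
  rewrite -[z]vsubmxK [dsubmx z]mx11_scalar in Fz *.
  exists (usubmx z); last by rewrite dual_costE.
  by apply/projection_feasibleP; exists (dsubmx z 0 0).
have [lam Flam] := (projection_feasibleP z).1 Fz.
by exists (col_mx z lam%:M) => //; rewrite dual_costE.
Qed.

Lemma optimal_dual x (lam : R) : optimal P2 (col_mx x lam%:M) -> optimal P1 x.
Proof.
move=> [Fx minx]; split; first by apply/projection_feasibleP; exists lam.
move=> x' /projection_feasibleP[lam' Fx'].
by rewrite -(dual_costE x lam) -(dual_costE x' lam'); exact: minx.
Qed.

End Equivalence.

Theorem mainTheorem3 (R : realType) (n : nat) (xc xg mu : 'cV[R]_n)
    (Sigma U D : 'M[R]_n) (mut : 'cV[R]_n)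
    (hSigma : posdef Sigma)
    (hU : U^T *m U = 1%:M)
    (hDdiag : is_diag_mx D)
    (hDpos : forall i, 0 < D i i)
    (heig : Sigma = U *m D *m U^T)
    (hmut : mut = invmx Sigma *m mu) :
  let P1 := projection_problem xc xg mu Sigma in
  let P2 := dual_problem xc xg Sigma U D mut in
  [/\ convex_problem P2,
      socp_representable (opt_of_ineq P2),
      optimal_value (opt_of_ineq P2) = optimal_value P1 &
      forall (x : 'cV[R]_n) (lam : R),
        optimal (opt_of_ineq P2) (col_mx x lam%:M) -> optimal P1 x].
Proof.
split.
- exact: dual_problem_convex.
- exact: dual_socp_representable.
- exact: optimal_value_dual.
- by move=> x lam; exact: optimal_dual.
Qed.
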